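(* Let $E$ be a nonzero reflexive real Banach space, $S,T\colon E\rightrightarrows E^*$ be maximally monotone, and suppose $\mathrm{dom}\,\varphi_S+\rho_1\mathrm{dom}\,\varphi_T=E\times E^*$. Then $(S+T)(E)=E^*$.
   Context: $\rho_1(x,x^* ):=(-x,x^* )$. For monotone $S$ with nonempty graph $G(S)$, $\varphi_S(x,x^* ):=\sup_{(s,s^* )\in G(S)}[\langle x,s^*\rangle+\langle s,x^*\rangle-\langle s,s^*\rangle]$, and $\mathrm{dom}\,\varphi_S:=\{(x,x^* )\colon \varphi_S(x,x^* )\in\mathbb{R}\}$. $(S+T)x:=\{y+z\colon y\in Sx,z\in Tx\}$ and $(S+T)(E):=\bigcup_{x\in E}(S+T)x$. *)

(* Defs.v *)
From HB Require Import structures.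
From mathcomp Require Import all_boot all_order all_algebra.
From mathcomp Require Import all_classical all_reals all_analysis.
Set Implicit Arguments. Unset Strict Implicit. Unset Printing Implicit Defensive.
Import Order.TTheory GRing.Theory Num.Theory.
Import numFieldNormedType.Exports.
Local Open Scope classical_set_scope.
Local Open Scope ring_scope.

Definition is_dual {R : realType} {E : normedModType R} (f : E -> R) : Prop :=
  (forall (a : R) (x y : E), f (a *: x + y) = a * f x + f y) /\ continuous f.

Definition dual_ball {R : realType} {E : normedModType R} (f : E -> R) : Prop :=
  is_dual f /\ forall x : E, `|f x| <= `|x|.

(* E is reflexive: the canonical embedding E -> E^** is onto, i.e. every
   continuous (= bounded) linear functional on E^* is an evaluation map. *)
Definition reflexive_space {R : realType} (E : normedModType R) : Prop :=
  forall Phi : (E -> R) -> R,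
    (forall (a : R) (f g : E -> R), is_dual f -> is_dual g ->
        Phi (fun y => a * f y + g y) = a * Phi f + Phi g) ->
    (exists C : R, forall f, dual_ball f -> `|Phi f| <= C) ->
    exists x : E, forall f, is_dual f -> Phi f = f x.

Definition into_dual {R : realType} {E : normedModType R}
  (S : E -> set (E -> R)) : Prop := forall x xs, S x xs -> is_dual xs.

Definition monotone_op {R : realType} {E : normedModType R}
  (S : E -> set (E -> R)) : Prop :=
  into_dual S /\
  forall x xs y ys, S x xs -> S y ys -> 0 <= xs x - xs y - ys x + ys y.

Definition maximally_monotone {R : realType} {E : normedModType R}
  (S : E -> set (E -> R)) : Prop :=
  monotone_op S /\
  forall T : E -> set (E -> R), monotone_op T ->
    (forall x xs, S x xs -> T x xs) -> forall x xs, T x xs -> S x xs.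

Definition fitzpatrick {R : realType} {E : normedModType R}
  (S : E -> set (E -> R)) (x : E) (xs : E -> R) : \bar R :=
  ereal_sup [set r | exists (s : E) (ss : E -> R),
    S s ss /\ r = (xs s + ss x - ss s)%:E].

Definition dom_fitz {R : realType} {E : normedModType R}
  (S : E -> set (E -> R)) : set (E * (E -> R)) :=
  [set p | is_dual p.2 /\ fitzpatrick S p.1 p.2 \is a fin_num].

(* Main.v *)
Require Import Defs.
From HB Require Import structures.
From mathcomp Require Import all_boot all_order all_algebra.
From mathcomp Require Import all_classical all_reals all_analysis.
From mathcomp Require Import ring lra.
Import Order.TTheory GRing.Theory Num.Theory.
Import numFieldNormedType.Exports.
Local Open Scope classical_set_scope.
Local Open Scope ring_scope.
Set Implicit Arguments. Unset Strict Implicit. Unset Printing Implicit Defensive.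

(* To show that xs is attained, put V := E * E^* and consider on V the convex
   functions f (a, a* ) := phi_S (a, a* ) and
   g (b, b* ) := phi_T (b, xs - b* ) - xs b.  By maximality phi_S and phi_T dominate
   the duality pairing, hence f + g >= 0, and the domain hypothesis reads
   dom f - dom g = V.  Fenchel duality then gives a bounded linear L on V with
   L (u - v) <= f u + g v; by reflexivity L (x, x* ) = ys x + x* y.  Evaluated on
   the graphs this says
     <s - y, s* - ys> + <t - y, t* - (xs - ys)> >= 0
   for all (s, s* ) in S and (t, t* ) in T, and maximality forces both
   (y, ys) in S and (y, xs - ys) in T.
   For Fenchel duality, the linear minorant L of the infimal convolution comes
   from a maximal convex cone (Zorn), and its continuity from Baire's theorem
   applied to differences of bounded sublevel sets of f and g. *)

(** * Continuous linear functionals and their bounds *)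

Section dual_functionals.
Context {R : realType} {E : normedModType R}.
Implicit Types (f g : E -> R) (x y : E).

Lemma is_dualZ f a x : is_dual f -> f (a *: x) = a * f x.
Proof.
case=> fl _; have f0 : f 0 = 0.
  by have := fl 1 0 0; rewrite scale1r mul1r addr0; lra.
by have := fl a x 0; rewrite addr0 f0 addr0.
Qed.

Lemma is_dual_bounded f : is_dual f ->
  exists C, 0 <= C /\ forall x, `|f x| <= C * `|x|.
Proof.
move=> df; have [fl fc] := df.
pose lf := GRing.isLinear.Build R E R^o *%R f fl.
pose F : {linear E -> R^o} := HB.pack f lf.
have /linear_boundedP /pinfty_ex_gt0 [C C0 fC] : bounded_near F (nbhs 0).
  by apply: continuous_linear_bounded; exact: fc.
by exists C; split; [exact: ltW | exact: fC].
Qed.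

Lemma bounded_is_dual f C :
  (forall a x y, f (a *: x + y) = a * f x + f y) ->
  (forall x, `|f x| <= C * `|x|) -> is_dual f.
Proof.
move=> fl fC; split=> //.
pose lf := GRing.isLinear.Build R E R^o *%R f fl.
pose F : {linear E -> R^o} := HB.pack f lf.
suff : continuous F by [].
apply: bounded_linear_continuous; apply/linear_boundedP.
near=> r => x; apply: (le_trans (fC x)).
by rewrite ler_wpM2r//; near: r; apply: nbhs_pinfty_ge; rewrite num_real.
Unshelve. all: by end_near. Qed.

Lemma is_dual_lin f g a : is_dual f -> is_dual g ->
  is_dual (fun x => a * f x + g x).
Proof.
move=> df dg; have [fl _] := df; have [gl _] := dg.
have [C [_ fC]] := is_dual_bounded df; have [D [_ gD]] := is_dual_bounded dg.
apply: (@bounded_is_dual _ (`|a| * C + D)) => [b x y|x].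
  by rewrite fl gl; lra.
rewrite mulrDl -mulrA (le_trans (ler_normD _ _))// normrM lerD//.
by rewrite ler_wpM2l.
Qed.

Lemma is_dual0 : is_dual (fun _ : E => 0 : R).
Proof.
apply: (@bounded_is_dual _ 0) => [a x y|x]; first by rewrite mulr0 addr0.
by rewrite normr0 mul0r.
Qed.

End dual_functionals.

(** * The dual space as a Banach space *)

Definition dual_pred {R : realType} (E : normedModType R) : {pred E -> R^o} :=
  fun f => `[< is_dual f >].

Arguments dual_pred {R} E.

Section dual_space.
Context {R : realType} (E : normedModType R).

Fact dual_pred_submod : submod_closed (dual_pred E).
Proof.
split=> [|a f g]; rewrite !unfold_in; first exact/asboolP/is_dual0.
by move=> /asboolP df /asboolP dg; apply/asboolP; exact: is_dual_lin.
Qed.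

HB.instance Definition _ :=
  GRing.isSubmodClosed.Build R (E -> R^o) (dual_pred E) dual_pred_submod.

Record dual := Dual { dual_fun : E -> R^o; _ : dual_fun \in dual_pred E }.

HB.instance Definition _ := [isSub for dual_fun].
HB.instance Definition _ := [Choice of dual by <:].
HB.instance Definition _ := [SubChoice_isSubLmodule of dual by <:].

End dual_space.

Section dual_norm.
Context {R : realType} (E : normedModType R).
Implicit Types (f g : dual E) (x y : E).

Lemma dual_funP f : is_dual (dual_fun f).
Proof. by case: f => f /=; rewrite unfold_in => /asboolP. Qed.

Lemma is_dual_mem (f : E -> R) : is_dual f -> (f : E -> R^o) \in dual_pred E.
Proof. by move=> df; rewrite unfold_in; apply/asboolP. Qed.

Definition dual_of (f : E -> R) (df : is_dual f) : dual E :=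
  Dual (is_dual_mem df).

Lemma dual_ext f g : (forall x, dual_fun f x = dual_fun g x) -> f = g.
Proof. by move=> fg; apply: val_inj; apply/funext. Qed.

Lemma dual_funZ a f x : dual_fun (a *: f) x = a * dual_fun f x.
Proof. by []. Qed.

Let bounds f : set R := [set C | 0 <= C /\ forall x, `|dual_fun f x| <= C * `|x|].

(** The operator norm, taken as the least admissible bound instead of a supremum over the unit
    ball. *)
Definition dual_norm f : R := inf (bounds f).

Let bounds_inf f : has_inf (bounds f).
Proof.
split; last by exists 0 => C [].
by have [C [C0 fC]] := is_dual_bounded (dual_funP f); exists C.
Qed.

Lemma dual_norm_le f C :
  0 <= C -> (forall x, `|dual_fun f x| <= C * `|x|) -> dual_norm f <= C.
Proof. by move=> C0 fC; apply: ge_inf; [exact: (bounds_inf f).2 | split]. Qed.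

Lemma dual_norm_ge f x : `|dual_fun f x| <= dual_norm f * `|x|.
Proof.
have [->|x0] := eqVneq x 0.
  have [C [_ /(_ 0)]] := is_dual_bounded (dual_funP f).
  by rewrite normr0 !mulr0.
rewrite -ler_pdivrMr ?normr_gt0//; apply: lb_le_inf; first exact: (bounds_inf f).1.
by move=> C [_ /(_ x)]; rewrite ler_pdivrMr ?normr_gt0.
Qed.

Lemma dual_norm_ge0 f : 0 <= dual_norm f.
Proof. by apply: lb_le_inf; [exact: (bounds_inf f).1 | move=> C []]. Qed.

Fact ler_dual_normD f g : dual_norm (f + g) <= dual_norm f + dual_norm g.
Proof.
apply: dual_norm_le => [|x]; first by rewrite addr_ge0// dual_norm_ge0.
by rewrite mulrDl (le_trans (ler_normD _ _))// lerD// dual_norm_ge.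
Qed.

Fact dual_normZ (a : R) f : dual_norm (a *: f) = `|a| * dual_norm f.
Proof.
(* One inequality suffices: used again with [a^-1] and [a *: f], it yields the converse. *)
have le b h : dual_norm (b *: h) <= `|b| * dual_norm h.
  apply: dual_norm_le => [|x]; first by rewrite mulr_ge0// dual_norm_ge0.
  by rewrite dual_funZ normrM -mulrA ler_wpM2l// dual_norm_ge.
apply/eqP; rewrite eq_le le /=.
have [->|a0] := eqVneq a 0; first by rewrite normr0 mul0r dual_norm_ge0.
have := le a^-1 (a *: f); rewrite scalerA mulVf// scale1r normfV.
by rewrite ler_pdivlMl ?normr_gt0.
Qed.

Fact dual_norm_eq0 f : dual_norm f = 0 -> f = 0.
Proof.
move=> f0; apply: dual_ext => x.
by have := dual_norm_ge f x; rewrite f0 mul0r normr_le0 => /eqP.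
Qed.

HB.instance Definition _ := Lmodule_isNormed.Build R (dual E)
  ler_dual_normD dual_normZ dual_norm_eq0.

Lemma ler_dual_fun f x : `|dual_fun f x| <= `|f| * `|x|.
Proof. exact: dual_norm_ge. Qed.

Lemma eval_continuous x : continuous (fun f => dual_fun f x : R).
Proof.
have evl : linear (fun f => dual_fun f x : R^o) by [].
pose ev : {linear dual E -> R^o} := HB.pack (fun f => dual_fun f x : R^o)
  (GRing.isLinear.Build R (dual E) R^o *%R _ evl).
suff : continuous ev by [].
apply: bounded_linear_continuous; apply/linear_boundedP.
near=> r => f /=; rewrite (le_trans (ler_dual_fun _ _))// mulrC.
rewrite ler_wpM2r//; near: r; apply: nbhs_pinfty_ge; rewrite num_real.
Unshelve. all: by end_near. Qed.

End dual_norm.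


(** A Cauchy filter converges at each point. The bounds on [f - g] are uniform up to the factor
    [|x|], so they pass to the pointwise limit, which is therefore bounded and a limit in norm. *)
Fact dual_complete {R : realType} (E : normedModType R)
    (F : set_system (dual E)) : ProperFilter F -> cauchy F -> cvg F.
Proof.
move=> FF Fc.
have Fnear e : 0 < e -> \forall f & g \near F, `|f - g| < e.
  by move=> e0; move/cauchy_ballP: Fc => /(_ e e0); rewrite -ball_normE.
have cvx x : cvg ((fun f => dual_fun f x : R) @ F).
  apply: cauchy_cvg; apply/cauchy_ballP => e e0.
  have ex0 : 0 < e / (`|x| + 1) by rewrite divr_gt0// ltr_wpDl.
  rewrite near_map2; apply: filterS (Fnear _ ex0) => -[f g] /=.
  rewrite ltr_pdivlMr ?ltr_wpDl// -ball_normE /=; apply: le_lt_trans.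
  rewrite -[X in `|X|]/(dual_fun (f - g) x) (le_trans (ler_dual_fun _ _))//.
  by rewrite ler_wpM2l// lerDl.
pose l x : R := lim ((fun f => dual_fun f x : R) @ F).
have lcv x : (fun f => dual_fun f x : R) @ F --> l x by exact: cvx.
have l_near e : 0 < e ->
    \forall f \near F, forall x, `|l x - dual_fun f x| <= e * `|x|.
  move=> e0; near=> f => x.
  have glcv : (fun g => `|dual_fun g x - dual_fun f x|) @ F
      --> `|l x - dual_fun f x|.
    by apply: cvg_norm; apply: cvgB; [exact: lcv|exact: cvg_cst].
  rewrite -(cvg_lim _ glcv)//; apply: limr_le.
    by apply/cvg_ex; eexists; exact: glcv.
  near=> g => /=.
  rewrite -[X in `|X|]/(dual_fun (g - f) x) (le_trans (ler_dual_fun _ _))//.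
  rewrite ler_wpM2r// distrC ltW//.
  by near: g; near: f; apply: nearP_dep; apply: Fnear.
have dl : is_dual l.
  have [f fl] := filter_ex (l_near _ ltr01).
  apply: (@bounded_is_dual _ _ _ (1 + `|f|)) => [a x y|x].
    apply: (cvg_unique _ (lcv _)) => //=.
    rewrite (_ : (fun g => _) = fun g => a * dual_fun g x + dual_fun g y); last first.
      by apply/funext => g; case: (dual_funP g) => + _; apply.
    by apply: cvgD; [apply: cvgM; [exact: cvg_cst|exact: lcv]|exact: lcv].
  rewrite -[l x](subrK (dual_fun f x)) (le_trans (ler_normD _ _))// mulrDl lerD//.
  exact: ler_dual_fun.
apply/cvg_ex; exists (dual_of dl); apply/cvgrPdist_le => e e0.
near=> f; apply: dual_norm_le; first exact: ltW.
by near: f; exact: l_near.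
Unshelve. all: by end_near. Qed.

HB.instance Definition _ (R : realType) (E : normedModType R) :=
  Uniform_isComplete.Build (dual E) (@dual_complete R E).

(** This makes Baire's theorem applicable on [E * dual E]. *)
Fact prod_complete (K : realType) (U V : completeNormedModType K)
    (F : set_system (U * V : normedModType K)%type) :
  ProperFilter F -> cauchy F -> cvg F.
Proof.
move=> FF /cauchyP Fc.
have F1 : cvg ((fun p : U * V => p.1) @ F).
  apply: cauchy_cvg; apply/cauchyP => e /Fc [[x y] Fxy]; exists x.
  by apply: (@filterS _ F _ (ball (x, y) e) _ _ Fxy) => p [].
have F2 : cvg ((fun p : U * V => p.2) @ F).
  apply: cauchy_cvg; apply/cauchyP => e /Fc [[x y] Fxy]; exists y.
  by apply: (@filterS _ F _ (ball (x, y) e) _ _ Fxy) => p [].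
apply/cvg_ex; exists ((lim ((fun p : U * V => p.1) @ F),
  lim ((fun p : U * V => p.2) @ F)) : (U * V : normedModType K)%type).
move=> A /(cvg_pair F1 F2) FA; by apply: (@filterS _ F _ _ _ _ FA) => -[].
Qed.

HB.instance Definition _ (K : realType) (U V : completeNormedModType K) :=
  Uniform_isComplete.Build (U * V)%type (@prod_complete K U V).

(** * Baire's theorem and differences of closed bounded convex sets *)

Definition convex_subset {R : realType} {V : lmodType R} (A : set V) :=
  forall (t : R) (u v : V), 0 <= t -> t <= 1 -> A u -> A v ->
    A (t *: u + (1 - t) *: v).

Section closed_convex_difference.
Context {R : realType} {V : completeNormedModType R}.
Implicit Types (C D K : set V) (u v w : V).

(** The weights of a partial sum fall short of 1 by [2^-1 ^+ n]; putting that mass on [u_ n] gives a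
    point of [C], and the correction tends to 0 since [C] is bounded. *)
Lemma dyadic_series_closed_convex C (M : R) (u_ : nat -> V) :
  closed C -> convex_subset C -> (forall u, C u -> `|u| <= M) ->
  (forall n, C (u_ n)) ->
  exists2 u, C u & [series 2^-1 ^+ i.+1 *: u_ i]_i @ \oo --> u.
Proof.
move=> Ccl Cconv CM Cu.
have cvgs : cvgn [series 2^-1 ^+ i.+1 *: u_ i]_i.
  apply: normed_cvg; apply: (@series_le_cvg _ _ (geometric M 2^-1)).
  - by move=> n /=.
  - move=> n; rewrite /geometric /= mulr_ge0 ?exprn_ge0//.
    exact: le_trans (CM _ (Cu 0)).
  - move=> n; rewrite /geometric /= normrZ ger0_norm ?exprn_ge0// mulrC.
    rewrite ler_pM ?CM ?exprn_ge0// exprS ler_piMl ?exprn_ge0//.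
    by rewrite invf_le1// ler1n.
  - by apply: is_cvg_geometric_series; rewrite ger0_norm// invf_lt1// ltr1n.
exists (limn [series 2^-1 ^+ i.+1 *: u_ i]_i) => //.
(* Induction over all sequences at once: the first term has weight one half, and the rest is half
   the same expression for the shifted sequence. *)
have Cs n : C ([series 2^-1 ^+ i.+1 *: u_ i]_i n + 2^-1 ^+ n *: u_ n).
  elim: n u_ Cu {cvgs} => [|n IHn] u_ Cu.
    by rewrite /series /= big_nil add0r expr0 scale1r.
  have := IHn (fun i => u_ i.+1) (fun i => Cu i.+1).
  move=> /(Cconv 2^-1 _ _ _ _ (Cu 0)); rewrite invr_ge0 ler0n invf_le1// ler1n.
  move=> /(_ isT isT).
  move=> Cn; suff -> : [series 2^-1 ^+ i.+1 *: u_ i]_i n.+1 + 2^-1 ^+ n.+1 *: u_ n.+1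
    = 2^-1 *: u_ 0 + (1 - 2^-1) *: ([series 2^-1 ^+ i.+1 *: u_ i.+1]_i n
        + 2^-1 ^+ n *: u_ n.+1) by [].
  rewrite /series /= big_nat_recl// expr1 -addrA; congr +%R.
  rewrite (_ : 1 - 2^-1 = 2^-1 :> R); last by field.
  rewrite scalerDr scaler_sumr scalerA -exprS; congr +%R.
  by apply: eq_bigr => i _; rewrite scalerA -exprS.
have cv : ([series 2^-1 ^+ i.+1 *: u_ i]_i n + 2^-1 ^+ n *: u_ n) @[n --> \oo] -->
    limn [series 2^-1 ^+ i.+1 *: u_ i]_i.
  rewrite -[X in _ --> X]addr0; apply: cvgD => //.
  apply/cvgr0Pnorm_le => e e0; near=> n.
  rewrite normrZ ger0_norm ?exprn_ge0//.
  rewrite (le_trans (ler_wpM2l _ (CM _ (Cu n)))) ?exprn_ge0//.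
  rewrite mulrC (le_trans (ler_norm _))//; near: n.
  apply: cvgr0_norm_le => //; apply: cvg_geometric.
  by rewrite ger0_norm// invf_lt1// ltr1n.
apply: (closed_cvg C) cv => //.
by near=> n; exact: Cs.
Unshelve. all: by end_near. Qed.

(** Absorption and star-shapedness make the multiples of [closure K] by [n.+1] cover the space; by
    Baire's theorem one of them has interior, and scaling back keeps a ball. *)
Lemma absorbing_somewhere_dense K :
  (forall w, exists2 t, 0 < t & K (t *: w)) ->
  (forall w t, K w -> 0 <= t -> t <= 1 -> K (t *: w)) ->
  exists x r, 0 < r /\ forall w, `|w - x| < r ->
    forall e, 0 < e -> exists2 k, K k & `|w - k| < e.
Proof.
move=> Kabs Kstar.
pose B n := [set w | closure K (n.+1%:R^-1 *: w)].
have Bcl n : closed (B n).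
  apply: preimage_closed; last exact: closed_closure.
  by move=> w _; exact: scaler_continuous.
have [n [U [U0 Uop UB]]] : exists n U, [/\ U !=set0, open U & U `<=` B n].
  apply: contrapT => /forallNP noB.
  have : dense (\bigcap_n (~` B n)).
    apply: Baire => n; split; first exact: closed_openC.
    move=> U U0 Uop; apply: contrapT => UB; apply: (noB n); exists U; split=> //.
    by move=> w Uw; apply: contrapT => Bw; apply: UB; exists w.
  move=> /(_ setT) Bw; have [| |w [_ {}Bw]] := Bw; [by exists 0|exact: openT|].
  have [t t0 Kt] := Kabs w.
  have [n nt] : exists n, n.+1%:R^-1 <= t.
    exists (Num.truncn t^-1); rewrite invf_ple ?posrE//.
    by rewrite ltW// truncnS_gt.
  apply: (Bw n) => //=; apply: subset_closure.
  rewrite -[_ *: w](_ : (n.+1%:R^-1 / t) *: (t *: w) = _).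
    by apply: Kstar => //; rewrite ?divr_ge0 ?ler_pdivrMr ?mul1r// ltW.
  by rewrite scalerA divfK ?gt_eqF.
have [y Uy] := U0.
have /nbhs_ballP [r /= r0 rU] : nbhs y U by exact: open_nbhs_nbhs.
have n1 : 0 < n.+1%:R :> R by [].
have n0 : 0 < n.+1%:R^-1 :> R by rewrite invr_gt0.
exists (n.+1%:R^-1 *: y), (n.+1%:R^-1 * r); split; first by rewrite mulr_gt0.
move=> w wy e e0.
have /UB : U (n.+1%:R *: w).
  apply: rU; rewrite -ball_normE /= distrC.
  have -> : n.+1%:R *: w - y = n.+1%:R *: (w - n.+1%:R^-1 *: y).
    by rewrite scalerBr scalerA mulfV ?scale1r ?lt0r_neq0.
  rewrite normrZ gtr0_norm//.
  by rewrite -ltr_pdivlMl.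
rewrite /B /= scalerA mulVf// scale1r => /(_ _ (nbhsx_ballx w e e0)) [k [Kk]].
by rewrite -ball_normE /= => wk; exists k.
Qed.

(** [K] also contains a positive multiple of [- x], opposite to the centre of the ball given by
    Baire; contracting the ball towards that point moves its centre to 0. *)
Lemma absorbing_closure_nbhs0 K :
  convex_subset K -> (forall w, exists2 t, 0 < t & K (t *: w)) ->
  exists2 r, 0 < r & forall w, `|w| < r ->
    forall e, 0 < e -> exists2 k, K k & `|w - k| < e.
Proof.
move=> Kconv Kabs.
have K0 : K 0 by have [t _] := Kabs 0; rewrite scaler0.
have [|x [r [r0 xK]]] := absorbing_somewhere_dense Kabs.
  by move=> w t Kw t0 t1; have := Kconv t w 0 t0 t1 Kw K0; rewrite scaler0 addr0.
have [t t0 Kt] := Kabs (- x).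
have t10 : 0 < 1 + t by rewrite addr_gt0.
(* [lam] solves [(1 - lam) * t = lam], so [lam *: x] and [(1 - lam) *: (t *: - x)] cancel. *)
pose lam := t / (1 + t).
have lam0 : 0 < lam by rewrite divr_gt0.
have lam1 : lam <= 1 by rewrite ler_pdivrMr// mul1r lerDr.
exists (lam * r); first by rewrite mulr_gt0.
move=> w wr e e0.
have [| |k Kk wk] := xK (x + lam^-1 *: w) _ (e / lam).
- by rewrite addrC addKr normrZ gtr0_norm ?invr_gt0// ltr_pdivrMl.
- by rewrite divr_gt0.
exists (lam *: k + (1 - lam) *: (t *: - x)).
  by apply: Kconv => //; exact: ltW.
have -> : w - (lam *: k + (1 - lam) *: (t *: - x)) =
    lam *: (x + lam^-1 *: w - k).
  have -> : (1 - lam) *: (t *: - x) = - (lam *: x).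
    rewrite scalerA (_ : (1 - lam) * t = lam) ?scalerN//.
    by rewrite /lam; field; rewrite gt_eqF.
  rewrite scalerBr scalerDr scalerA mulfV ?gt_eqF// scale1r.
  by rewrite opprB addrA [w + _]addrC.
by rewrite normrZ gtr0_norm// -ltr_pdivlMl// mulrC.
Qed.

(** Successive approximation as in the open mapping theorem: the two dyadic series converge
    separately, in [C] and in [D], so the limit is an exact difference. *)
Lemma difference_nbhs0 C D (M : R) :
  closed C -> convex_subset C -> (forall u, C u -> `|u| <= M) ->
  closed D -> convex_subset D -> (forall u, D u -> `|u| <= M) ->
  (forall w, exists2 t, 0 < t & exists u v, [/\ C u, D v & t *: w = u - v]) ->
  exists2 r, 0 < r & forall w, `|w| < r -> exists u v, [/\ C u, D v & w = u - v].
Proof.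
move=> Ccl Cconv CM Dcl Dconv DM CDabs.
pose K := [set w | exists u v, [/\ C u, D v & w = u - v]].
have Kconv : convex_subset K.
  move=> t _ _ t0 t1 [u [v [Cu Dv ->]]] [u' [v' [Cu' Dv' ->]]].
  exists (t *: u + (1 - t) *: u'), (t *: v + (1 - t) *: v').
  split; [exact: Cconv|exact: Dconv|].
  by rewrite !scalerBr opprD addrACA.
have [r r0 Kr] := absorbing_closure_nbhs0 Kconv CDabs.
(* With this radius [2 *: d] stays in the ball of radius [r], whose points are approximated from
   [C - D]. *)
exists (r / 2) => [|w wr]; first by rewrite divr_gt0.
(* Each remainder d equals half of an element u - v of C - D plus half of a new
   remainder d' = 2 d - (u - v), which stays in the same ball. *)
have step d : exists p : V * V, `|d| < r / 2 ->
    [/\ C p.1, D p.2 & `|2 *: d - (p.1 - p.2)| < r / 2].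
  (* [(0, 0)] is a junk pair for [d] outside the ball; it lets [choice] apply to every [d]. *)
  have [dr|] := ltP `|d| (r / 2); last by exists (0, 0).
  have [| |_ [u [v [Cu Dv ->]]] duv] := Kr (2 *: d) _ (r / 2).
  - by rewrite normrZ ger0_norm// mulrC -ltr_pdivlMr.
  - by rewrite divr_gt0.
  by exists (u, v).
have [p pP] := choice step.
pose d_ n := iter n (fun d => 2 *: d - ((p d).1 - (p d).2)) w.
have dr n : `|d_ n| < r / 2.
  by elim: n => [//|n IHn]; have [] := pP _ IHn.
have Cp n : C (p (d_ n)).1 by have [] := pP _ (dr n).
have Dp n : D (p (d_ n)).2 by have [] := pP _ (dr n).
have [u Cu ucv] := dyadic_series_closed_convex Ccl Cconv CM Cp.
have [v Dv vcv] := dyadic_series_closed_convex Dcl Dconv DM Dp.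
exists u, v; split=> //.
have rem n : w = [series 2^-1 ^+ i.+1 *: (p (d_ i)).1]_i n
    - [series 2^-1 ^+ i.+1 *: (p (d_ i)).2]_i n + 2^-1 ^+ n *: d_ n.
  elim: n => [|n IHn].
    by rewrite /series /= !big_nil subr0 add0r expr0 scale1r.
  rewrite [LHS]IHn /series /= !big_nat_recr//= opprD addrACA -[RHS]addrA.
  congr +%R; rewrite -scalerBr -scalerDr addrC subrK scalerA exprSr.
  by rewrite -mulrA mulVf// mulr1.
have dcv : 2^-1 ^+ n *: d_ n @[n --> \oo] --> (0 : V).
  apply/cvgr0Pnorm_le => e e0; near=> n.
  rewrite normrZ ger0_norm ?exprn_ge0//.
  rewrite (le_trans (ler_wpM2l _ (ltW (dr n)))) ?exprn_ge0//.
  rewrite mulrC (le_trans (ler_norm _))//; near: n.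
  apply: cvgr0_norm_le => //; apply: cvg_geometric.
  by rewrite ger0_norm// invf_lt1// ltr1n.
have : (fun=> w) @ \oo --> u - v + 0.
  rewrite (funext rem); apply: cvgD dcv; exact: cvgB.
rewrite addr0 => wcv.
by apply: (cvg_unique _ (cvg_cst w) wcv).
Unshelve. all: by end_near. Qed.

End closed_convex_difference.

(** * Linear minorants from maximal convex cones *)

Section convex_minorant.
Context {R : realType} {V : lmodType R}.
Implicit Types (A B G : set (V * R^o)) (x y : V) (r t : R).

(** The second coordinate is a height; the last clause keeps the cone from dropping below 0 over the
    origin, so that a linear functional can fit beneath it. *)
Definition proper_cone A :=
  [/\ A 0, forall p p', A p -> A p' -> A (p + p'),
      forall t p, 0 < t -> A p -> A (t *: p)
    & forall r, A (0, r) -> 0 <= r].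

(** Zorn runs over sets [A] with [A] united to [H] a proper cone, rather than over cones containing
    [H], so that the empty chain, with union [set0], is covered. *)
Let maximal_cone (H : set (V * R^o)) : proper_cone H ->
  exists G, [/\ proper_cone G, H `<=` G &
    forall B, proper_cone B -> G `<=` B -> B `<=` G].
Proof.
move=> Hcone; have [|A [Acone Amax]] :=
    @Zorn_bigcup _ [set A | proper_cone (A `|` H)].
  move=> F FH Ftot /=.
  have [[X0 FX0]|F0] := pselect (exists X, F X); last first.
    rewrite (_ : \bigcup_(X in F) X = set0) ?set0U//.
    by rewrite -subset0 => p [X FX]; case: F0; exists X.
  have XH X : F X -> X `|` H `<=` \bigcup_(X in F) X `|` H.
    by move=> FX p [Xp|Hp]; [left; exists X|right].
  have common p q : (\bigcup_(X in F) X `|` H) p ->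
      (\bigcup_(X in F) X `|` H) q ->
      exists X, [/\ F X, (X `|` H) p & (X `|` H) q].
    move=> [[X FX Xp]|Hp] [[Y FY Yq]|Hq].
    - have [XY|YX] := Ftot _ _ FX FY.
        by exists Y; split=> //; left=> //; exact: XY.
      by exists X; split=> //; left=> //; exact: YX.
    - by exists X; split=> //; [left|right].
    - by exists Y; split=> //; [right|left].
    - by exists X0; split=> //; right.
  split.
  - by right; case: Hcone.
  - move=> p q /common /[apply] -[X [FX Xp Xq]].
    by apply: (XH _ FX); have [_ + _ _] := FH _ FX; apply.
  - move=> t p t0 Xp; have [X [FX {}Xp _]] := common _ _ Xp Xp.
    by apply: (XH _ FX); have [_ _ + _] := FH _ FX; apply.
  - move=> r Xr; have [X [FX {}Xr _]] := common _ _ Xr Xr.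
    by have [_ _ _] := FH _ FX; apply.
exists (A `|` H); split=> // B Bcone GB.
have BH : B `|` H = B.
  by apply/seteqP; split=> p; [case=> // Hp; apply: GB; right|left].
apply: contrapT => BG; apply: (Amax B); last by rewrite /= BH.
split; last by apply: contra_not BG => BA p /BA; left.
by move=> p Ap; apply: GB; left.
Qed.

(** The lower boundary [L x] of [G] over [x] is sublinear because [G] is a cone; maximality makes it
    odd, hence linear. *)
Let linear_minorant_cone G : proper_cone G ->
  (forall B, proper_cone B -> G `<=` B -> B `<=` G) ->
  (forall x, exists r, G (x, r)) ->
  exists2 L : V -> R, (forall a x y, L (a *: x + y) = a * L x + L y)
    & forall x r, G (x, r) -> L x <= r.
Proof.
move=> [G0 GD GZ Gpos] Gmax Gtot.
have Gpair x r q : G (x, r) -> G (- x, q) -> 0 <= r + q.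
  move=> Gr Gq; have := GD _ _ Gr Gq.
  by rewrite -[(_, _) + _]/(_ + _, _ + _) /= subrr; exact: Gpos.
(* If there is no such [q], adjoining the ray through [(x, r)] leaves the cone proper, so maximality
   puts [(x, r)] in [G]. *)
have Gdich x r : ~ G (x, r) -> exists2 q, q < - r & G (- x, q).
  apply: contra_notP => noq.
  pose B := [set p | exists g t, [/\ G g, 0 <= t & p = g + t *: ((x, r) : V * R^o)]].
  have : B `<=` G.
    apply: Gmax => [|g Gg]; last by exists g, 0; split=> //; rewrite scale0r addr0.
    split.
    - by exists 0, 0; split=> //; rewrite scale0r addr0.
    - move=> _ _ [g [t [Gg t0 ->]]] [h [s [Gh s0 ->]]].
      exists (g + h), (t + s); split; [exact: GD|exact: addr_ge0|].
      by rewrite scalerDl addrACA.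
    - move=> s _ s0 [g [t [Gg t0 ->]]].
      exists (s *: g), (s * t); split; [exact: GZ|by rewrite mulr_ge0// ltW|].
      by rewrite scalerDr scalerA.
    - move=> q [[y s] [t [Gg t0 [yE sE]]]].
      move: t0; rewrite le_eqVlt => /predU1P[t0|t0].
        move: yE sE; rewrite -t0 !scale0r !addr0 => yE sE.
        by apply: Gpos; rewrite sE yE.
      rewrite leNgt; apply/negP => q0; apply: noq; exists (t^-1 * s).
        rewrite mulrC ltr_pdivrMr// mulNr.
        have : s = q - t * r by rewrite sE addrK.
        by move=> ->; rewrite mulrC -subr_gt0 opprB addrCA addrA; lra.
      have : G (t^-1 *: y, t^-1 * s) by apply: (GZ t^-1 (y, s)) => //; rewrite invr_gt0.
      suff -> : t^-1 *: y = - x by [].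
      have -> : y = - (t *: x) by apply/eqP; rewrite -addr_eq0 -yE.
      by rewrite scalerN scalerA mulVf ?gt_eqF// scale1r.
  by apply; exists 0, 1; split=> //; rewrite scale1r add0r.
pose L x : R := inf [set r | G (x, r)].
have Linf x : has_inf [set r | G (x, r)].
  split; first by have [r Gr] := Gtot x; exists r.
  have [q Gq] := Gtot (- x); exists (- q) => r /= Gr.
  by rewrite -subr_ge0 opprK; exact: Gpair Gr Gq.
have Lle x r : G (x, r) -> L x <= r.
  by move=> Gr; apply: ge_inf => //; exact: (Linf x).2.
have Lge x c : (forall r, G (x, r) -> c <= r) -> c <= L x.
  by move=> cG; apply: lb_le_inf; [exact: (Linf x).1 | exact: cG].
have LN x : L (- x) <= - L x.
  (* [r] is the midpoint of [- L (- x)] and [L x]; being below [L x], it puts [(x, r)] outside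
     [G]. *)
  rewrite leNgt; apply/negP => LNx; pose r := (L x - L (- x)) / 2.
  have /Gdich [q qr /Lle] : ~ G (x, r) by move=> /Lle; rewrite /r; lra.
  by move: qr; rewrite /r; lra.
have LD x y : L (x + y) <= L x + L y.
  rewrite -lerBlDr; apply: (Lge) => r Gr; rewrite lerBlDr -lerBlDl.
  apply: Lge => q Gq; rewrite lerBlDl; apply: Lle; exact: (GD _ _ Gr Gq).
have LDE x y : L (x + y) = L x + L y.
  apply/eqP; rewrite eq_le LD /=.
  have := LD (x + y) (- y); rewrite addrK; have := LN y; lra.
have L0 : L 0 = 0 by have := LDE 0 0; rewrite addr0; lra.
have LNE x : L (- x) = - L x by have := LDE x (- x); rewrite subrr L0; lra.
have LZ_le t x : 0 < t -> t * L x <= L (t *: x).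
  move=> t0; apply: Lge => r Gr; rewrite mulrC -ler_pdivlMr//.
  apply: Lle; rewrite mulrC.
  have := @GZ t^-1 _ _ Gr; rewrite -[_ *: (_, _)]/(_ *: _, _ *: _) /= scalerA.
  by rewrite mulVf ?gt_eqF// scale1r; apply; rewrite invr_gt0.
have LZ_pos t x : 0 < t -> L (t *: x) = t * L x.
  move=> t0; apply/eqP; rewrite eq_le LZ_le// andbT.
  have := @LZ_le t^-1 (t *: x); rewrite invr_gt0 scalerA mulVf ?gt_eqF// scale1r.
  by move=> /(_ t0); rewrite mulrC ler_pdivrMr// mulrC.
exists L => // a x y; rewrite LDE; congr +%R.
have [a0|a0|->] := ltgtP a 0; last by rewrite scale0r mul0r.
  by rewrite -[a]opprK scaleNr LNE (@LZ_pos (- a)) ?oppr_gt0// [in RHS]mulNr.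
exact: LZ_pos.
Qed.

(** The cone generated by [H] is proper, since scaling a point over 0 leaves it over 0; a maximal
    cone above it provides [L]. *)
Lemma convex_linear_minorant (H : set (V * R^o)) :
  convex_subset H -> (forall x, exists r, H (x, r)) ->
  (forall r, H (0, r) -> 0 <= r) ->
  exists2 L : V -> R, (forall a x y, L (a *: x + y) = a * L x + L y)
    & forall x r, H (x, r) -> L x <= r.
Proof.
move=> Hconv Htot Hpos.
pose H' : set (V * R^o) := [set p | p = 0 \/ exists2 t : R, 0 < t & H (t *: p)].
have Hcone : proper_cone H'.
  split; first by left.
  - move=> p q [->|[t t0 Hp]]; first by rewrite add0r.
    move=> [->|[s s0 Hq]]; first by rewrite addr0; right; exists t.
    have ts0 : 0 < t + s by rewrite addr_gt0.
    (* Weights [s / (t + s)] on [t *: p] and [t / (t + s)] on [s *: q] give [p] and [q] this common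
       factor. *)
    right; exists (s * t / (t + s)); first by rewrite divr_gt0// mulr_gt0.
    have := Hconv (s / (t + s)) _ _ _ _ Hp Hq.
    rewrite !scalerA (_ : (1 - s / (t + s)) * s = s * t / (t + s)); last first.
      by field; rewrite gt_eqF.
    rewrite mulrAC scalerDr; apply; first by rewrite divr_ge0// ltW.
    by rewrite ler_pdivrMr// mul1r lerDr ltW.
  - move=> t p t0 [->|[s s0 Hp]]; first by rewrite scaler0; left.
    right; exists (s / t); first by rewrite divr_gt0.
    by rewrite scalerA divfK ?gt_eqF.
  - move=> r [[->]//|[t t0]]; rewrite -[_ *: (_, _)]/(_ *: _, _ *: _) /= scaler0.
    by move=> /Hpos; rewrite pmulr_rge0.
have [G [Gcone HG Gmax]] := maximal_cone Hcone.
have HG' x r : H (x, r) -> G (x, r).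
  by move=> Hr; apply: HG; right; exists 1; rewrite ?scale1r.
have [|L Llin LG] := linear_minorant_cone Gcone Gmax.
  by move=> x; have [r /HG' Gr] := Htot x; exists r.
by exists L => // x r /HG'; exact: LG.
Qed.

End convex_minorant.

(** * Fenchel duality for epigraphs *)

Section epigraph_sandwich.
Context {R : realType} {V : completeNormedModType R}.

Let affine_bound (a b t s : R) : 0 <= t -> t <= 1 -> t * s <= 1 -> a <= s ->
  t * a + (1 - t) * b <= 1 + `|b|.
Proof.
move=> t0 t1 ts as_; rewrite lerD//; first by rewrite (le_trans _ ts)// ler_wpM2l.
rewrite (le_trans (ler_norm _))// normrM ger0_norm ?subr_ge0// ler_piMl//.
by rewrite lerBlDr lerDl.
Qed.

(** Scaling [w] to norm [r / 2] gives the upper bound; [- w] gives the lower one. *)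
Lemma bounded_above_near0 (L : V -> R) (r M : R) : 0 < r ->
  (forall a x y, L (a *: x + y) = a * L x + L y) ->
  (forall w, `|w| < r -> L w <= M) -> exists C, forall w, `|L w| <= C * `|w|.
Proof.
move=> r0 Llin LM.
have L0 : L 0 = 0 by have := Llin 1 0 0; rewrite scale1r mul1r addr0; lra.
have LZ a x : L (a *: x) = a * L x by have := Llin a x 0; rewrite !addr0 L0 addr0.
have upper w : L w <= (2 * M / r) * `|w|.
  have [->|w0] := eqVneq w 0; first by rewrite L0 normr0 mulr0.
  have w0' : 0 < `|w| by rewrite normr_gt0.
  have := LM ((r / 2 / `|w|) *: w).
  rewrite normrZ gtr0_norm ?divr_gt0// divfK ?normr_eq0// LZ.
  rewrite gtr_pMr// invf_lt1// ltr1n => /(_ isT).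
  rewrite -ler_pdivlMl ?divr_gt0// => /le_trans; apply.
  by rewrite le_eqVlt; apply/orP; left; apply/eqP; field; rewrite !gt_eqF.
exists (2 * M / r) => w; rewrite ler_norml upper andbT lerNl.
by rewrite -mulN1r -LZ scaleN1r -(normrN w).
Qed.

(* Fenchel duality: F and G play the role of epigraphs of two convex lower
   semicontinuous functions. *)
Lemma epigraph_sandwich (F G : set (V * R^o)) :
  convex_subset F -> convex_subset G ->
  (forall r, closed [set u | F (u, r)]) -> (forall r, closed [set u | G (u, r)]) ->
  (forall u r q, F (u, r) -> r <= q -> F (u, q)) ->
  (forall u r q, G (u, r) -> r <= q -> G (u, q)) ->
  (forall w, exists u v r q, [/\ F (u, r), G (v, q) & w = u - v]) ->
  (forall u r q, F (u, r) -> G (u, q) -> 0 <= r + q) ->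
  exists L : V -> R, [/\ forall a x y, L (a *: x + y) = a * L x + L y,
    exists C, forall w, `|L w| <= C * `|w|
    & forall u v r q, F (u, r) -> G (v, q) -> L (u - v) <= r + q].
Proof.
move=> Fconv Gconv Fcl Gcl Fup Gup dom diag.
(* The lower boundary of [H] is the infimal convolution, whose value at [w] is the infimum of
   heights over [w = u - v]. *)
pose H : set (V * R^o) := [set p | exists u v r q,
  [/\ F (u, r), G (v, q) & p = (u - v, r + q)]].
have [|w|r|L Llin LH] := @convex_linear_minorant _ _ H.
- move=> t _ _ t0 t1 [u [v [r [q [Fu Gv ->]]]]] [u' [v' [r' [q' [Fu' Gv' ->]]]]].
  exists (t *: u + (1 - t) *: u'), (t *: v + (1 - t) *: v').
  exists (t * r + (1 - t) * r'), (t * q + (1 - t) * q').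
  split; [exact: (Fconv t (u, r) (u', r'))|exact: (Gconv t (v, q) (v', q'))|].
  congr pair; first by rewrite /= !scalerBr opprD addrACA.
  by rewrite /= /GRing.scale /=; ring.
- have [u [v [r [q [Fu Gv ->]]]]] := dom w.
  by exists (r + q), u, v, r, q.
- move=> [u [v [s [q [Fu Gv [/esym/eqP]]]]]].
  by rewrite subr_eq0 => /eqP vu ->; apply: (diag u) => //; rewrite vu.
have Lle u v r q : F (u, r) -> G (v, q) -> L (u - v) <= r + q.
  by move=> Fu Gv; apply: LH; exists u, v, r, q.
exists L; split=> //.
have [u0 [v0 [r0 [q0 [Fu0 Gv0 uv0]]]]] := dom 0.
(* The anchor [u0 = v0] lies in both sublevel sets with room to spare: one unit is left for the
   damped contribution of any other point. *)
pose N := 1 + `|r0| + `|q0| + `|u0| + `|v0|.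
have sub_closed (A : set (V * R^o)) : (forall r, closed [set u | A (u, r)]) ->
    closed [set u | A (u, N) /\ `|u| <= N].
  move=> Acl; apply: closedI (Acl N) _.
  apply: (@preimage_closed _ _ (fun u : V => `|u|) [set x | x <= N]).
    by move=> u _; exact: norm_continuous.
  exact: closed_le.
have sub_convex (A : set (V * R^o)) : convex_subset A ->
    convex_subset [set u | A (u, N) /\ `|u| <= N].
  move=> Aconv t u v t0 t1 [Au uN] [Av vN]; split.
    have := Aconv t _ _ t0 t1 Au Av.
    rewrite -[_ *: (_, _) + _]/(_ + _, _ + _) /= /GRing.scale /=.
    by rewrite -mulrDl [t + _]addrC subrK mul1r.
  rewrite (le_trans (ler_normD _ _))// !normrZ !ger0_norm ?subr_ge0//.
  rewrite (le_trans (lerD (ler_wpM2l t0 uN) (ler_wpM2l _ vN))) ?subr_ge0//.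
  by rewrite -mulrDl [t + _]addrC subrK mul1r.
have sub_absorb (A : set (V * R^o)) (u u1 : V) (r r1 t s : R) : convex_subset A ->
    (forall u r q, A (u, r) -> r <= q -> A (u, q)) ->
    A (u, r) -> A (u1, r1) -> `|r1| + 1 <= N -> `|u1| + 1 <= N ->
    0 <= t -> t <= 1 -> t * s <= 1 -> r <= s -> `|u| <= s ->
    A (t *: u + (1 - t) *: u1, N) /\ `|t *: u + (1 - t) *: u1| <= N.
  move=> Aconv Aup Au Au1 r1N u1N t0 t1 ts rs us; split.
    apply: (Aup _ _ _ (Aconv t _ _ t0 t1 Au Au1)).
    by rewrite (le_trans (affine_bound _ t0 t1 ts rs))// addrC.
  rewrite (le_trans (ler_normD _ _))// !normrZ !ger0_norm ?subr_ge0//.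
  by rewrite (le_trans (affine_bound _ t0 t1 ts us))// normr_id addrC.
have [|rho rho0 ball_rho] := @difference_nbhs0 _ _ _ _ N
  (sub_closed _ Fcl) (sub_convex _ Fconv) (fun u => @proj2 _ _)
  (sub_closed _ Gcl) (sub_convex _ Gconv) (fun u => @proj2 _ _).
- move=> w; have [u [v [r [q [Fu Gv ->]]]]] := dom w.
  (* [s] dominates all heights and norms involved, so weight [(1 + s)^-1] contributes at most 1.
     Moving [u] and [v] towards the common anchor scales their difference. *)
  pose s := `|r| + `|q| + `|u| + `|v|.
  have s0 : 0 <= s by rewrite !addr_ge0.
  have s1 : 0 < 1 + s by rewrite ltr_pwDl.
  have t0 : 0 < (1 + s)^-1 by rewrite invr_gt0.
  have t1 : (1 + s)^-1 <= 1 by rewrite invf_le1// lerDl.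
  have ts : (1 + s)^-1 * s <= 1 by rewrite mulrC ler_pdivrMr// mul1r lerDr.
  have [r_ q_ u_ v_] : [/\ 0 <= `|r|, 0 <= `|q|, 0 <= `|u| & 0 <= `|v|] by [].
  have [rr qq] : r <= `|r| /\ q <= `|q| by rewrite !ler_norm.
  have [a b c d] : [/\ 0 <= `|r0|, 0 <= `|q0|, 0 <= `|u0| & 0 <= `|v0|] by [].
  exists (1 + s)^-1 => //.
  exists ((1 + s)^-1 *: u + (1 - (1 + s)^-1) *: u0).
  exists ((1 + s)^-1 *: v + (1 - (1 + s)^-1) *: v0).
  split.
  - by apply: (sub_absorb F u u0 r r0 _ s) => //; rewrite /N /s; try lra; exact: ltW.
  - by apply: (sub_absorb G v v0 q q0 _ s) => //; rewrite /N /s; try lra; exact: ltW.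
  - by rewrite opprD addrACA -!scalerBr -uv0 scaler0 addr0.
(* On this ball [w = u - v] with both heights equal to [N], hence [L w <= N + N]. *)
apply: (bounded_above_near0 rho0 Llin) => w /ball_rho [u [v [[Fu _] [Gv _] ->]]].
exact: Lle Fu Gv.
Qed.

End epigraph_sandwich.

(** * Suprema of continuous affine functions *)

Section affine_supremum.
Context {R : realType} {V : normedModType R}.

Definition affine_fun (l : V -> R) :=
  forall (t : R) u v, l (t *: u + (1 - t) *: v) = t * l u + (1 - t) * l v.

(** The epigraph of the pointwise supremum, described without forming that supremum, so that
    infinite values never appear. *)
Definition sup_epigraph (Phi : set (V -> R)) : set (V * R^o) :=
  [set p | forall l, Phi l -> l p.1 <= p.2].

Lemma sup_epigraph_convex (Phi : set (V -> R)) :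
  (forall l, Phi l -> affine_fun l) -> convex_subset (sup_epigraph Phi).
Proof.
move=> Paff t [u r] [v q] t0 t1 lu lv l Pl /=.
rewrite (Paff _ Pl) lerD// ler_wpM2l ?subr_ge0//; [exact: lu|exact: lv].
Qed.

Lemma sup_epigraph_closed (Phi : set (V -> R)) (r : R) :
  (forall l, Phi l -> continuous l) -> closed [set u | sup_epigraph Phi (u, r)].
Proof.
move=> Pcont.
rewrite (_ : mkset _ = \bigcap_(l in Phi) (l @^-1` [set x | x <= r])); last first.
  by apply/seteqP; split=> u lu l Pl; exact: lu.
apply: closed_bigI => l Pl; apply: preimage_closed; last exact: closed_le.
by move=> u _; exact: Pcont.
Qed.

Lemma sup_epigraph_up (Phi : set (V -> R)) u (r q : R) :
  sup_epigraph Phi (u, r) -> r <= q -> sup_epigraph Phi (u, q).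
Proof. by move=> lu rq l /lu /le_trans; exact. Qed.

End affine_supremum.

(** * Maximal monotonicity and the Fitzpatrick function *)

Section maximal_monotonicity.
Context {R : realType} {E : normedModType R}.
Implicit Types (S : E -> set (E -> R)) (x y : E) (xs ys : E -> R).

(** Adding [(y, ys)] to the graph keeps it monotone. *)
Lemma maximally_monotone_mem S y ys : maximally_monotone S -> is_dual ys ->
  (forall s ss, S s ss -> 0 <= ss s - ss y - ys s + ys y) -> S y ys.
Proof.
move=> [[Sdual Smono] Smax] dys Sy.
pose S' x := [set xs | S x xs \/ x = y /\ xs = ys].
apply: (Smax S'); [|by move=> x xs; left|by right].
split=> [x xs [/Sdual//|[_ ->]//]|x xs z zs].
move=> [Sx|[-> ->]] [Sz|[-> ->]]; [exact: Smono|exact: Sy| |by rewrite subrr add0r addNr].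
by have := Sy _ _ Sz; lra.
Qed.

(** If [r < ys y], the bound makes [(y, ys)] monotonically related to the graph, hence a point of
    it, where the bound reads [ys y <= r]. So the Fitzpatrick function dominates the pairing. *)
Lemma fitzpatrick_ge S y ys (r : R) : maximally_monotone S -> is_dual ys ->
  (forall s ss, S s ss -> ys s + ss y - ss s <= r) -> ys y <= r.
Proof.
move=> Smax dys Sr; rewrite leNgt; apply/negP => rys.
have /Sr : S y ys.
  by apply: maximally_monotone_mem => // s ss /Sr; move: rys; lra.
by move: rys; lra.
Qed.

Lemma dom_fitz_bounded S x xs : dom_fitz S (x, xs) ->
  exists r : R, forall s ss, S s ss -> xs s + ss x - ss s <= r.
Proof.
move=> [_ /= fin]; exists (fine (fitzpatrick S x xs)) => s ss Ss.
by rewrite -lee_fin fineK//; apply: ereal_sup_ubound; exists s, ss.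
Qed.

End maximal_monotonicity.

(** * Bounded functionals on the product of a reflexive space and its dual *)

Section reflexive_product.
Context {R : realType} {E : completeNormedModType R}.

(** [L] splits along the factors: its restriction to [E] is [ys], and its restriction to the dual is
    evaluation at some [y] by reflexivity. *)
Lemma reflexive_product_functional (L : E * dual E -> R) (C : R) :
  reflexive_space E ->
  (forall (a : R) u v, L (a *: u + v) = a * L u + L v) ->
  (forall w, `|L w| <= C * `|w|) ->
  exists y ys, is_dual ys /\ forall x g, L (x, g) = ys x + dual_fun g y.
Proof.
move=> Erefl Llin LC.
have pairE (a : R) (x x' : E) (f f' : dual E) :
  (a *: x + x', a *: f + f') = a *: (x, f) + (x', f') by [].
have norm1 x : `|(x, 0) : E * dual E| = `|x|.
  by rewrite prod_normE /= normr0; apply/max_idPl.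
have norm2 f : `|(0, f) : E * dual E| = `|f|.
  by rewrite prod_normE /= normr0; apply/max_idPr.
(* [reflexive_space] takes functionals defined on all functions, so [L] is extended by the default 0
   off the dual. *)
pose Phi (f : E -> R) : R :=
  if pselect (is_dual f) is left df then L (0, dual_of df) else 0.
have PhiE (g : dual E) : Phi (dual_fun g) = L (0, g).
  rewrite /Phi; case: pselect => [df|]; last by have := dual_funP g.
  by congr (L (_, _)); exact: dual_ext.
have [a f g df dg||y yP] := Erefl Phi.
- rewrite -[f]/(dual_fun (dual_of df)) -[g]/(dual_fun (dual_of dg)).
  rewrite -[fun _ => _]/(dual_fun (a *: dual_of df + dual_of dg)) !PhiE.
  by rewrite -Llin -pairE scaler0 addr0.
- exists `|C| => f [df fle].
  rewrite -[f]/(dual_fun (dual_of df)) PhiE (le_trans (LC _))// norm2.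
  rewrite (le_trans (ler_wpM2r _ (ler_norm C)))// ler_piMr//.
  by apply: dual_norm_le => // x; rewrite mul1r.
exists y, (fun x => L (x, 0)); split=> [|x g].
  apply: (@bounded_is_dual _ _ _ C) => [a x x'|x]; last by rewrite -norm1.
  by rewrite -Llin -pairE scaler0 addr0.
rewrite -yP ?PhiE; last exact: dual_funP.
by rewrite -[L (x, 0)]mul1r -Llin -pairE scale1r addr0 scale1r add0r.
Qed.

End reflexive_product.

(** * Surjectivity of the sum *)

Unset Implicit Arguments.

Theorem theorem7p2 (R : realType) (E : completeNormedModType R)
  (S T : E -> set (E -> R)) :
  (exists x : E, x != 0) ->
  reflexive_space E ->
  maximally_monotone S -> maximally_monotone T ->
  (forall (x : E) (xs : E -> R), is_dual xs ->
     exists a b : E, exists as_ bs : E -> R,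
       dom_fitz S (a, as_) /\ dom_fitz T (b, bs) /\
       x = a - b /\ xs = (fun y => as_ y + bs y)) ->
  [set xs | exists x : E, exists ys zs : E -> R,
      S x ys /\ T x zs /\ xs = (fun y => ys y + zs y)]
  = [set xs | is_dual xs].
Proof.
move=> _ Erefl Smax Tmax dom; apply/seteqP; split=> [xs|xs dxs].
  move=> [x [ys [zs [Sys [Tzs ->]]]]] /=.
  have dys : is_dual ys by exact: Smax.1.1 Sys.
  have dzs : is_dual zs by exact: Tmax.1.1 Tzs.
  rewrite (_ : (fun y => _) = fun y => 1 * ys y + zs y); first exact: is_dual_lin.
  by apply/funext => y; rewrite mul1r.
have [[Sdual Smono] _] := Smax; have [[Tdual Tmono] _] := Tmax.
have xsc := dxs.2.
(* The suprema of these affine functions over the graphs are [f] and [g] of the overview. *)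
pose lS (s : E) (ss : E -> R) (p : E * dual E) : R := dual_fun p.2 s + ss p.1 - ss s.
pose lT (t : E) (tt : E -> R) (p : E * dual E) : R :=
  xs t - dual_fun p.2 t + tt p.1 - tt t - xs p.1.
pose PhiS := [set l | exists s ss, S s ss /\ l = lS s ss].
pose PhiT := [set l | exists t tt, T t tt /\ l = lT t tt].
have dual_affine (f : E -> R) : is_dual f -> affine_fun f.
  by move=> df a x y; rewrite df.1 is_dualZ.
have dualB f g (df : is_dual f) (dg : is_dual g) (x : E) :
  dual_fun (dual_of df - dual_of dg) x = f x - g x by [].
have combo1 (a : R) (u v : E * dual E) :
  (a *: u + (1 - a) *: v).1 = a *: u.1 + (1 - a) *: v.1 by [].
have combo2 (a : R) (u v : E * dual E) x : dual_fun (a *: u + (1 - a) *: v).2 x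
  = a * dual_fun u.2 x + (1 - a) * dual_fun v.2 x by [].
have Saff l : PhiS l -> affine_fun l.
  move=> [s [ss [Sss ->]]] a u v; rewrite /lS combo1 combo2.
  by rewrite (dual_affine _ (Sdual _ _ Sss)); ring.
have Taff l : PhiT l -> affine_fun l.
  move=> [t [tt [Ttt ->]]] a u v; rewrite /lT combo1 combo2.
  by rewrite (dual_affine _ (Tdual _ _ Ttt)) (dual_affine _ dxs); ring.
have fst_cont (f : E -> R) : continuous f -> continuous (fun p : E * dual E => f p.1).
  by move=> fc p; apply: continuous_comp; [exact: cvg_fst|exact: fc].
have snd_cont s : continuous (fun p : E * dual E => dual_fun p.2 s : R).
  move=> p; apply: (@continuous_comp _ _ _ snd (fun f => dual_fun f s : R)).
    exact: cvg_snd.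
  exact: eval_continuous.
have Scont l : PhiS l -> continuous l.
  move=> [s [ss [Sss ->]]] p; apply: cvgB; last exact: cvg_cst.
  by apply: cvgD; [exact: snd_cont|exact: fst_cont _ (Sdual _ _ Sss).2 p].
have Tcont l : PhiT l -> continuous l.
  move=> [t [tt [Ttt ->]]] p; apply: cvgB; last exact: fst_cont _ xsc p.
  apply: cvgB; last exact: cvg_cst.
  apply: cvgD; last exact: fst_cont _ (Tdual _ _ Ttt).2 p.
  by apply: cvgB; [exact: cvg_cst|exact: snd_cont].
have [[x g]|[a f] r q Sr Tq|L [Llin [C LC] Lle]] := epigraph_sandwich
  (sup_epigraph_convex Saff) (sup_epigraph_convex Taff)
  (fun r => @sup_epigraph_closed _ _ PhiS r Scont)
  (fun r => @sup_epigraph_closed _ _ PhiT r Tcont)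
  (@sup_epigraph_up _ _ PhiS) (@sup_epigraph_up _ _ PhiT).
(* The shift by [xs] turns [as_ + bs = g + xs] into [as_ - (xs - bs) = g]. *)
- have [|a [b [as_ [bs [Sa [Tb [-> gE]]]]]]] := dom x (fun y => dual_fun g y + xs y).
    have -> : (fun y => dual_fun g y + xs y) = fun y => 1 * dual_fun g y + xs y.
      by apply/funext => y; rewrite mul1r.
    by apply: is_dual_lin => //; exact: dual_funP.
  have [r Sr] := dom_fitz_bounded Sa; have [q Tq] := dom_fitz_bounded Tb.
  have das : is_dual as_ := Sa.1; have dbs : is_dual bs := Tb.1.
  exists (a, dual_of das), (b, dual_of dxs - dual_of dbs), r, (q - xs b); split.
  + by move=> _ [s [ss [Sss ->]]]; exact: Sr.
  + move=> _ [t [tt [Ttt ->]]]; rewrite /lT dualB /=.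
    by have := Tq _ _ Ttt; lra.
  + congr pair; apply: dual_ext => y.
    rewrite -[RHS]/(as_ y - (xs y - bs y)).
    by have /(congr1 (fun h => h y)) := gE; lra.
(* On the diagonal, domination of the pairing gives [f a <= r] for [S] and [- f a <= q] for [T]. *)
- have dxf : is_dual (fun y => - 1 * dual_fun f y + xs y).
    by apply: is_dual_lin => //; exact: dual_funP.
  have fa : dual_fun f a <= r.
    apply: (fitzpatrick_ge Smax (dual_funP f)) => s ss Sss.
    by apply: (Sr (lS s ss)); exists s, ss.
  have := fitzpatrick_ge (r := q + xs a) Tmax dxf.
  have Ta t tt : T t tt -> - 1 * dual_fun f t + xs t + tt a - tt t <= q + xs a.
    move=> Ttt; have : lT t tt (a, f) <= q by apply: Tq; exists t, tt.
    by rewrite /lT /=; lra.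
  by move=> /(_ a Ta); move: fa; lra.
have [y [ys [dys LE]]] := reflexive_product_functional Erefl Llin LC.
(* [L] is compared at [(s, ss)] and [(t, xs - tt)]; by monotonicity the heights [ss s] and
   [tt t - xs t] are admissible there. *)
have key s ss t tt : S s ss -> T t tt ->
    0 <= (ss s - ss y - ys s + ys y)
      + (tt t - tt y - (xs t - ys t) + (xs y - ys y)).
  move=> Sss Ttt; have dss := Sdual _ _ Sss; have dtt := Tdual _ _ Ttt.
  have := Lle (s, dual_of dss) (t, dual_of dxs - dual_of dtt) (ss s) (tt t - xs t).
  have -> : L ((s, dual_of dss) - (t, dual_of dxs - dual_of dtt)) =
      ys s - ys t + (ss y - (xs y - tt y)).
    rewrite -[_ - _]/(s - t, dual_of dss - (dual_of dxs - dual_of dtt)) LE.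
    rewrite -[dual_fun _ y]/(ss y - (xs y - tt y)); congr +%R.
    by rewrite addrC -scaleN1r dys.1 mulN1r addrC.
  have Ss : sup_epigraph PhiS ((s, dual_of dss), ss s).
    move=> _ [s' [ss' [Sss' ->]]]; rewrite /lS /=.
    by have := Smono _ _ _ _ Sss Sss'; lra.
  have Tt : sup_epigraph PhiT ((t, dual_of dxs - dual_of dtt), tt t - xs t).
    move=> _ [t' [tt' [Ttt' ->]]]; rewrite /lT dualB /=.
    by have := Tmono _ _ _ _ Ttt Ttt'; lra.
  by move=> /(_ Ss Tt); lra.
have dxy : is_dual (fun x => - 1 * ys x + xs x) by exact: is_dual_lin.
have Tmem : (forall t tt, T t tt ->
    0 <= tt t - tt y - (xs t - ys t) + (xs y - ys y)) ->
    T y (fun x => - 1 * ys x + xs x).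
  move=> Tpos; apply: maximally_monotone_mem => // t tt /Tpos; lra.
have Sy : S y ys.
  apply: maximally_monotone_mem => // s ss Sss.
  (* A negative [S]-term forces all [T]-terms to be positive, so [(y, xs - ys)] lies in [T]; at that
     point the [T]-term is 0, contradicting [key]. *)
  rewrite leNgt; apply/negP => s0.
  have : T y (fun x => - 1 * ys x + xs x).
    by apply: Tmem => t tt Ttt; have := key _ _ _ _ Sss Ttt; move: s0; lra.
  by move=> /(key _ _ _ _ Sss); move: s0; lra.
exists y, ys, (fun x => - 1 * ys x + xs x); split=> //; split.
  (* At [(y, ys)] the [S]-term of [key] vanishes, leaving the [T]-term nonnegative. *)
  by apply: Tmem => t tt Ttt; have := key _ _ _ _ Sy Ttt; lra.
by apply/funext => x; rewrite mulN1r addrA subrr add0r.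
Qed.
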